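(* Let $\mathcal{S}$ be a closed-loop multi-agent system with $N$ agents, with dynamics $\dot x_i=f_i(x_i)+g_i(x_i)u_i+w_i(t)$, $\|w_i(t)\|_2\le\bar w$, controlled by a $\psi$-weighted control barrier function (with $\psi$-weighted pairwise safety functions $\tilde h_{ij}$), where: 1. The initial state $x(0)$ satisfies all pairwise conditions $\tilde h_{ij}(x(0),u(0))\ge h_{\min}>0$ for all $i\ne j$. 2. The deterministic admissibility condition holds: for each pair $(i,j)$, the control input $u(t)$ ensures $$\dot{\tilde h}_{ij}(x(t),u(t))\ \ge\ -\alpha\big(\tilde h_{ij}(x(t),u(t))\big)+\gamma_{ij}(t),$$ where $$\gamma_{ij}(t)\ \ge\ \sup_{\|w_i(t)\|,\|w_j(t)\|\le\bar w}\big|\nabla h_{ij}(x(t))^\top(w_i(t)-w_j(t))\big|$$ exceeds the worst-case disturbance effect. 3. $P$ independent Monte Carlo rollouts are performed under bounded stochastic disturbances; $(Z_p)_{p=1}^P\in[0,1]$ denote the normalized safety margins of the rollouts, and $\theta\in(0,1)$ is a user-defined violation threshold. Let $X_p=\mathbb{1}[Z_p<\theta]$, $\hat p_v=\frac1P\sum_{p=1}^P X_p$ and $\hat\sigma^2=\frac{1}{P(P-1)}\sum_{1\le i<j\le P}(X_i-X_j)^2$. Then, with probability at least $1-\delta$ over future disturbance realizations, the system satisfies $$\mathbb{P}[Z<\theta]\ \le\ \hat p_v+\sqrt{\frac{2\hat\sigma^2\log(2/\delta)}{P}}+\frac{7\log(2/\delta)}{3(P-1)} .$$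
   Context: System: there are $N$ agents with states $x_i\in\mathbb{R}^n$, control inputs $u_i\in\mathbb{R}^m$ and stochastic disturbances $w_i(t)\in\mathbb{R}^n$ with $\|w_i(t)\|_2\le\bar w$ for a constant $\bar w>0$. The maps $f_i:\mathbb{R}^n\to\mathbb{R}^n$ and $g_i:\mathbb{R}^n\to\mathbb{R}^{n\times m}$ are locally Lipschitz continuous. Write $x=(x_1,\dots,x_N)$, $u=(u_1,\dots,u_N)$. The function $\alpha:\mathbb{R}\to\mathbb{R}$ is an extended class-$\mathcal{K}$ function, i.e. continuous, strictly increasing, with $\alpha(0)=0$. The time horizon is $T>0$, $P\in\mathbb{N}$, and $\delta\in(0,1)$ is a confidence parameter. $\psi$-weighted pairwise safety function: for agents $i\ne j$, let $h_{ij}:\mathbb{R}^{Nn}\to\mathbb{R}$ be continuously differentiable (encoding a minimum separation constraint), let $\psi\ge0$ be a scalar and $\varepsilon>0$ a tiny constant, and set $$\mathcal{A}_{ij}(x)=\frac{x_i-x_j}{\sqrt{\|x_i-x_j\|_2^2+\varepsilon^2}}\exp\!\big(-\|x_i-x_j\|_2^2\big),\qquad \tilde h_{ij}(x,u)=h_{ij}(x)+\psi\,\mathcal{A}_{ij}^\top(u_i-u_j).$$ $\dot{\tilde h}_{ij}$ denotes the time derivative of $\tilde h_{ij}$ along the system dynamics, and $\nabla h_{ij}$ denotes the gradient of $h_{ij}$, paired with $w_i-w_j$ as written. Normalized safety margins: rollout $p$ is a closed-loop simulation $(x^{(p)},u^{(p)})$ on $[0,T]$ with its own realization of the bounded noise.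 Let $\mathcal{V}^{(p)}$ be the event that $\tilde h_{ij}(x^{(p)}(t),u^{(p)}(t))<0$ for some $t\in[0,T]$ and some $i\ne j$. Then $Z_p=0$ if $\mathcal{V}^{(p)}$ occurs, and otherwise $$Z_p=\min_{t\in[0,T],\,i\ne j}\frac{\tilde h_{ij}(x^{(p)}(t),u^{(p)}(t))}{\max(\tilde h_{ij}^{\max},\epsilon)},$$ where $\tilde h_{ij}^{\max}$ is the maximum margin observed across all $P$ rollouts and $\epsilon>0$ is a small constant. $Z$ denotes a generic such margin. The collection $X_1,\dots,X_P$ is modeled as i.i.d. samples from a Bernoulli distribution with unknown probability $\mathbb{P}[Z<\theta]$. *)

(* Defs.v *)
From HB Require Import structures.
From mathcomp Require Import all_boot all_order all_algebra.
From mathcomp Require Import all_classical all_reals all_analysis.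

Set Implicit Arguments.
Unset Strict Implicit.
Unset Printing Implicit Defensive.

Import Order.TTheory GRing.Theory Num.Theory.
Import numFieldNormedType.Exports.

Local Open Scope classical_set_scope.
Local Open Scope ring_scope.

(* The norm `|x| of a matrix type is the sup norm, hence an explicit Euclidean
   inner product and norm. *)
Definition dotp (R : realType) (n : nat) (v w : 'cV[R]_n) : R :=
  \sum_(k < n) v k 0 * w k 0.

Definition norm2 (R : realType) (n : nat) (v : 'cV[R]_n) : R :=
  Num.sqrt (dotp v v).

(* The pairing of A_ij (a vector of R^n) with u_i - u_j (a vector of R^m) is
   the inner product when m = n; for m <> n the shorter vector is padded with
   zeros. *)
Definition pad_dotp (R : realType) (n m : nat) (v : 'cV[R]_n) (w : 'cV[R]_m)
    : R :=
  \sum_(k < n) \sum_(l < m | (l : nat) == k) v k 0 * w l 0.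

Definition locally_lipschitz (R : realType) (V W : normedModType R)
    (f : V -> W) : Prop :=
  [locally [lipschitz f x | x in [set: V]]].

Definition extended_class_K (R : realType) (alpha : R -> R) : Prop :=
  [/\ continuous alpha, {homo alpha : s t / s < t} & alpha 0 = 0].

(* A joint state (x_1, ..., x_N) is the n x N matrix with columns x_i; joint
   inputs and disturbances are encoded in the same way. *)
Definition continuously_differentiable (R : realType) (n N : nat)
    (h : 'M[R]_(n, N) -> R) : Prop :=
  (forall x, differentiable h x) /\
  (forall k i, continuous (fun x => 'D_(delta_mx k i) h x)).

(* Gradient with respect to the state x_i of agent i: this is the block of the
   gradient that can be paired with w_i - w_j. When h depends on x_i - x_j only,
   this pairing equals that of the full gradient of h with (w_1, ..., w_N). *)
Definition agent_grad (R : realType) (n N : nat) (i : 'I_N)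
    (h : 'M[R]_(n, N) -> R) (x : 'M[R]_(n, N)) : 'cV[R]_n :=
  \col_(k < n) 'D_(delta_mx k i) h x.

(* The vector A_ij(x). *)
Definition pair_dir (R : realType) (n N : nat) (eps : R) (i j : 'I_N)
    (x : 'M[R]_(n, N)) : 'cV[R]_n :=
  let d := col i x - col j x in
  (expR (- norm2 d ^+ 2) / Num.sqrt (norm2 d ^+ 2 + eps ^+ 2)) *: d.

Definition htilde (R : realType) (n m N : nat)
    (h : 'I_N -> 'I_N -> 'M[R]_(n, N) -> R) (psi eps : R) (i j : 'I_N)
    (x : 'M[R]_(n, N)) (u : 'M[R]_(m, N)) : R :=
  h i j x + psi * pad_dotp (pair_dir eps i j x) (col i u - col j u).

(* One realization of a closed-loop simulation. *)
Record trajectory (R : realType) (n m N : nat) := Trajectory {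
  state : R -> 'M[R]_(n, N);
  input : R -> 'M[R]_(m, N);
  noise : R -> 'M[R]_(n, N) }.

Definition absolutely_continuous (R : realType) (V : normedModType R) (a b : R)
    (phi : R -> V) : Prop :=
  forall e : R, 0 < e -> exists2 d : R, 0 < d &
    forall (k : nat) (l r : 'I_k -> R),
      (forall c, a <= l c /\ l c <= r c /\ r c <= b) ->
      trivIset setT (fun c => `]l c, r c[%classic) ->
      \sum_(c < k) (r c - l c) < d ->
      \sum_(c < k) `|phi (r c) - phi (l c)| < e.

(* x_i' = f_i(x_i) + g_i(x_i) u_i + w_i on [0, T] in the sense of Caratheodory:
   a bounded disturbance may be discontinuous. *)
Definition dynamics (R : realType) (n m N : nat)
    (f : 'I_N -> 'cV[R]_n -> 'cV[R]_n) (g : 'I_N -> 'cV[R]_n -> 'M[R]_(n, m))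
    (T : R) (pi : trajectory R n m N) : Prop :=
  forall i,
    absolutely_continuous 0 T (fun t => col i (state pi t)) /\
    {ae (@lebesgue_measure R), forall t : R, 0 < t < T ->
       is_derive t 1 (fun s => col i (state pi s))
         (f i (col i (state pi t))
          + g i (col i (state pi t)) *m col i (input pi t)
          + col i (noise pi t))}.

Definition bounded_noise (R : realType) (n m N : nat) (wbar T : R)
    (pi : trajectory R n m N) : Prop :=
  forall t i, 0 <= t <= T -> norm2 (col i (noise pi t)) <= wbar.

Definition margin (R : realType) (n m N : nat)
    (h : 'I_N -> 'I_N -> 'M[R]_(n, N) -> R) (psi eps : R)
    (pi : trajectory R n m N) (i j : 'I_N) (t : R) : R :=
  htilde h psi eps i j (state pi t) (input pi t).

Definition initially_safe (R : realType) (n m N : nat)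
    (h : 'I_N -> 'I_N -> 'M[R]_(n, N) -> R) (psi eps hmin : R)
    (pi : trajectory R n m N) : Prop :=
  forall i j : 'I_N, i != j -> hmin <= margin h psi eps pi i j 0.

Definition worst_disturbance (R : realType) (n N : nat)
    (h : 'I_N -> 'I_N -> 'M[R]_(n, N) -> R) (wbar : R) (i j : 'I_N)
    (x : 'M[R]_(n, N)) : R :=
  sup [set v | exists wi wj : 'cV[R]_n, [/\ norm2 wi <= wbar, norm2 wj <= wbar &
         v = `|dotp (agent_grad i (h i j) x) (wi - wj)|]].

(* The margin is differentiated along the trajectory, with the same regularity
   as the trajectory itself. If it is continuous on [0, T] and satisfies the
   inequality at every t of ]0, T[, then its derivative is bounded below, hence
   integrable, and the margin is absolutely continuous. *)
Definition admissible (R : realType) (n m N : nat)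
    (h : 'I_N -> 'I_N -> 'M[R]_(n, N) -> R) (psi eps wbar T : R)
    (alpha : R -> R) (pi : trajectory R n m N) : Prop :=
  exists gamma : 'I_N -> 'I_N -> R -> R, forall i j : 'I_N, i != j ->
    [/\ forall t, 0 <= t <= T ->
          worst_disturbance h wbar i j (state pi t) <= gamma i j t,
        absolutely_continuous 0 T (margin h psi eps pi i j : R -> R^o) &
        {ae (@lebesgue_measure R), forall t : R, 0 < t < T ->
           derivable (margin h psi eps pi i j : R -> R^o) t 1 /\
           - alpha (margin h psi eps pi i j t) + gamma i j t
             <= derive1 (margin h psi eps pi i j : R -> R^o) t}].

Definition cbf_trajectory (R : realType) (n m N : nat)
    (f : 'I_N -> 'cV[R]_n -> 'cV[R]_n) (g : 'I_N -> 'cV[R]_n -> 'M[R]_(n, m))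
    (h : 'I_N -> 'I_N -> 'M[R]_(n, N) -> R) (psi eps wbar T : R)
    (alpha : R -> R) (hmin : R) (pi : trajectory R n m N) : Prop :=
  [/\ dynamics f g T pi, bounded_noise wbar T pi,
      initially_safe h psi eps hmin pi &
      admissible h psi eps wbar T alpha pi].

(* The sets `{a coordinate of (x(t), u(t), w(t)) belongs to B}' with t in [0, T]
   and B Borel; they generate the sigma-algebra of the random rollout rho. *)
Definition rollout_events (R : realType) (n m N : nat) (Omega : Type) (T : R)
    (rho : Omega -> trajectory R n m N) : set (set Omega) :=
  [set E | exists (t : R) (B : set R) (i : 'I_N),
     [/\ 0 <= t <= T, measurable B &
       [\/ exists k, E = [set om | B (state (rho om) t k i)],
           exists k, E = [set om | B (input (rho om) t k i)] |
           exists k, E = [set om | B (noise (rho om) t k i)]]]].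

Definition independent_families (R : realType) (d : measure_display)
    (Omega : measurableType d) (Pr : probability Omega R) (I : finType)
    (F : I -> set (set Omega)) : Prop :=
  forall (J : {set I}) (E : I -> set Omega),
    (forall p : I, p \in J -> F p (E p)) ->
    Pr (\bigcap_(p in [set` J]) E p) = (\prod_(p in J) Pr (E p))%E.

Definition independent_rollouts (R : realType) (n m N K : nat)
    (d : measure_display) (Omega : measurableType d) (Pr : probability Omega R)
    (T : R) (rho : 'I_K -> Omega -> trajectory R n m N) : Prop :=
  (forall p, rollout_events T (rho p) `<=` measurable) /\
  independent_families Pr (fun p => <<s rollout_events T (rho p) >>).

Definition iid_bernoulli (R : realType) (K : nat) (d : measure_display)
    (Omega : measurableType d) (Pr : probability Omega R)
    (X : 'I_K -> Omega -> bool) (q : R) : Prop :=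
  [/\ forall p, measurable_fun setT (X p),
      independent_families Pr
        (fun p => preimage_set_system setT (X p) measurable) &
      forall p, pushforward Pr (X p) =1 bernoulli_prob q].

(* Maximum margin of the pair (i, j) over all rollouts and all times; it is
   attained when the margins are continuous in time. *)
Definition max_margin (R : realType) (n m N K : nat)
    (h : 'I_N -> 'I_N -> 'M[R]_(n, N) -> R) (psi eps T : R)
    (pis : 'I_K -> trajectory R n m N) (i j : 'I_N) : R :=
  sup [set v | exists (p : 'I_K) (t : R),
         0 <= t <= T /\ v = margin h psi eps (pis p) i j t].

Definition violation (R : realType) (n m N : nat)
    (h : 'I_N -> 'I_N -> 'M[R]_(n, N) -> R) (psi eps T : R)
    (pi : trajectory R n m N) : Prop :=
  exists (t : R) (i j : 'I_N),
    [/\ 0 <= t <= T, i != j & margin h psi eps pi i j t < 0].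

(* Normalized safety margin of the trajectory pi, with the normalization given
   by the observed rollouts pis. The infimum is a minimum when the margins are
   continuous in time. *)
Definition normalized_margin (R : realType) (n m N K : nat)
    (h : 'I_N -> 'I_N -> 'M[R]_(n, N) -> R) (psi eps epsn T : R)
    (pis : 'I_K -> trajectory R n m N) (pi : trajectory R n m N) : R :=
  if `[< violation h psi eps T pi >] then 0 else
  inf [set v | exists (t : R) (i j : 'I_N),
         [/\ 0 <= t <= T, i != j &
             v = margin h psi eps pi i j t
                 / Num.max (max_margin h psi eps T pis i j) epsn]].

Definition sample_mean (R : realType) (K : nat) (X : 'I_K -> bool) : R :=
  K%:R^-1 * \sum_(p < K) (X p)%:R.

Definition sample_var (R : realType) (K : nat) (X : 'I_K -> bool) : R :=
  (K%:R * (K%:R - 1))^-1 *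
  \sum_(p < K) \sum_(q < K | (p < q)%N) ((X p)%:R - (X q)%:R) ^+ 2.

(* Main.v *)
Require Import Defs.
From mathcomp Require Import all_boot all_order all_algebra.
From mathcomp Require Import all_classical all_reals all_analysis.
From mathcomp Require Import ring lra.

Set Implicit Arguments.
Unset Strict Implicit.
Unset Printing Implicit Defensive.

Import Order.TTheory GRing.Theory Num.Theory.
Import numFieldNormedType.Exports.

Local Open Scope classical_set_scope.
Local Open Scope ring_scope.

(* Let k be the number of successes among K Bernoulli(q) samples, a = k/K, and
   l = ln (2/delta) / K. The sample variance is a function of k alone and is at
   least a (1 - a). If the bound fails at a, then
   q - a >= sqrt (2 a (1 - a) l) + 2 l, hence (q - a)^2 >= 2 (a (1 - a) + q - a) l.
   For a <= x <= q one has x (1 - x) <= a (1 - a) + q - a, so this forces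
   KL(a || q) >= l. Comparing the laws of the samples for the parameters q and
   a, with a the largest bad frequency, bounds the probability of failure by
   exp (- K l) = delta / 2. *)

(** * Relative entropy of Bernoulli laws *)

(** With [a] fixed, right minus left vanishes at [q = a]; so it is enough that the left side does
    not increase on [[a, q]]. *)
Lemma bernoulli_kl_ge (R : realType) (a q : R) : 0 < a -> a <= q -> q < 1 ->
  a * ln q + (1 - a) * ln (1 - q) + (q - a) ^+ 2 / (2 * (a * (1 - a) + (q - a)))
    <= a * ln a + (1 - a) * ln (1 - a).
Proof.
move=> a0 aq q1.
pose v := a * (1 - a).
have v0 : 0 < v by rewrite /v; nra.
(* With [y = x - a], this uses [y^2 / (v + y) = y - v + v^2 / (v + y)], which leaves a single
   inverse to differentiate. *)
pose phi (x : R) := a * ln x + (1 - a) * ln (1 - x) +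
  2^-1 * (x - a - v + v ^+ 2 * (v + (x - a))^-1).
have phiE x : a <= x ->
  phi x = a * ln x + (1 - a) * ln (1 - x) + (x - a) ^+ 2 / (2 * (v + (x - a))).
  move=> ax; rewrite /phi; congr (_ + _).
  have vx : v + (x - a) != 0 by rewrite gt_eqF// ltr_pwDl// subr_ge0.
  by field; rewrite vx.
pose dphi x := a * x^-1 - (1 - a) * (1 - x)^-1 +
  2^-1 * (1 - v ^+ 2 * (v + (x - a)) ^- 2).
have phi_der x : a <= x -> x < 1 -> is_derive x 1 phi (dphi x).
  move=> ax x1.
  have x0 : 0 < x by lra.
  have x10 : 0 < 1 - x by lra.
  have vx : v + (x - a) != 0 by rewrite gt_eqF// ltr_pwDl// subr_ge0.
  have dln := is_derive1_ln x0.
  have dln1 : is_derive x 1 (fun y : R => ln (1 - y)) (- (1 - x)^-1).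
    have d1 := is_derive1_ln x10.
    have -> : - (1 - x)^-1 = (1 - x)^-1 * (0 - 1) by rewrite sub0r mulrN1.
    exact: (@is_derive1_comp _ (@ln R) (fun y : R => 1 - y)).
  have dinv : is_derive x 1 (fun y : R => (v + (y - a))^-1)
      (- (v + (x - a)) ^- 2 *: (1 : R)).
    have d2 : is_derive x 1 (fun y : R => v + (y - a)) 1.
      by apply: is_derive_eq; rewrite add0r subr0 mulr1.
    exact: is_deriveV.
  rewrite /phi; apply: is_derive_eq.
  rewrite /dphi /GRing.scale /=; field.
  by rewrite vx !gt_eqF.
rewrite -/v -phiE//.
have -> : a * ln a + (1 - a) * ln (1 - a) = phi a.
  by rewrite phiE// subrr expr0n mul0r addr0.
have itvP x : x \in `[a, q]%R -> a <= x /\ x < 1.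
  by rewrite in_itv/= => /andP[-> xq]; split=> //; exact: le_lt_trans q1.
apply: (@ler0_derive1_le_cc R phi a q _ _ _ q a) => // [x|x|||].
- rewrite in_itv/= => /andP[/ltW ax xq].
  by have [] := phi_der x ax (lt_trans xq q1).
- rewrite in_itv/= => /andP[/ltW ax xq].
  rewrite derive1E.
  have x1 := lt_trans xq q1.
  have [_ ->] := phi_der x ax x1.
  have x0 : 0 < x by lra.
  have x10 : 0 < 1 - x by lra.
  have vx : 0 < v + (x - a) by rewrite ltr_pwDl// subr_ge0.
  rewrite /dphi.
  (* The sign is that of the middle factor, which is at most 0 because [x (1 - x) <= v + (x - a)]
     and [2 v + (x - a) <= 2 (v + (x - a))]. *)
  have -> : a / x - (1 - a) / (1 - x) +
      2^-1 * (1 - v ^+ 2 * (v + (x - a)) ^- 2) =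
      (x - a) * (x * (1 - x) * (2 * v + (x - a)) - 2 * (v + (x - a)) ^+ 2) /
      (2 * x * (1 - x) * (v + (x - a)) ^+ 2).
    by field; rewrite !gt_eqF.
  rewrite pmulr_lle0; last first.
    by rewrite invr_gt0 !mulr_gt0// exprn_gt0.
  apply: mulr_ge0_le0; first by rewrite subr_ge0.
  have h1 : x * (1 - x) <= v + (x - a) by rewrite /v; nra.
  have h2 : x * (1 - x) * (2 * v + (x - a)) <= (v + (x - a)) * (2 * v + (x - a)).
    by apply: ler_wpM2r => //; lra.
  by nra.
- apply: continuous_in_subspaceT => x /set_mem/= /itvP[ax x1].
  have [dx _] := phi_der x ax x1.
  by apply: differentiable_continuous; exact/derivable1_diffP.
- by rewrite bound_itvE.
- by rewrite bound_itvE.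
Qed.

Lemma bernoulli_weight_le (R : realType) (k n : nat) (q l : R) :
  (k < n)%N -> let a := k%:R / n%:R in
  a < q <= 1 -> 2 * (a * (1 - a) + (q - a)) * l <= (q - a) ^+ 2 ->
  q ^+ k * (1 - q) ^+ (n - k) <=
    expR (- (n%:R * l)) * (a ^+ k * (1 - a) ^+ (n - k)).
Proof.
move=> kn a /andP[aq q1] hl.
have n0 : 0 < n%:R :> R by rewrite ltr0n; apply: leq_trans kn.
have a0 : 0 <= a by rewrite divr_ge0.
have a1 : a < 1 by rewrite ltr_pdivrMr// mul1r ltr_nat.
move: q1; rewrite le_eqVlt => /predU1P[->|q1].
  rewrite subrr expr0n subn_eq0 leqNgt kn/= mulr0.
  by rewrite mulr_ge0 ?expR_ge0// mulr_ge0// exprn_ge0// subr_ge0 ltW.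
have q0 : 0 < q by apply: le_lt_trans aq.
(* The entropy bound requires [0 < a]. At [a = 0] the hypothesis reads [2 l <= q], and
   [1 - q <= exp (- q)] is enough. *)
have [k0|k0] := posnP k.
  have aE : a = 0 by rewrite /a k0 mul0r.
  move: hl; rewrite aE k0 subn0 !expr0 !mul0r !mul1r add0r !subr0 expr1n mulr1.
  move=> hl.
  have h2 : l <= q.
    have : 2 * l <= q by rewrite -(ler_pM2l q0) mulrA (mulrC q) -expr2.
    by move=> h2; lra.
  rewrite mulrC -mulNr expRM_natr.
  apply: lerXn2r; rewrite ?nnegrE ?expR_ge0 ?subr_ge0 ?(ltW q1)//.
  apply: (le_trans (expR_ge1Dx (- q))).
  by rewrite ler_expR lerN2.
have a_gt0 : 0 < a by rewrite divr_gt0// ltr0n.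
have := bernoulli_kl_ge a_gt0 (ltW aq) q1.
have vD : 0 < 2 * (a * (1 - a) + (q - a)) by nra.
have : l <= (q - a) ^+ 2 / (2 * (a * (1 - a) + (q - a))).
  by rewrite ler_pdivlMr// mulrC.
set K := _ / _ => lK hK.
(* The exponents are [k = n a] and [n - k = n (1 - a)]. *)
have E1 (x : R) : 0 < x -> x < 1 ->
    x ^+ k * (1 - x) ^+ (n - k) =
    expR (n%:R * (a * ln x + (1 - a) * ln (1 - x))).
  move=> x0 x1.
  rewrite -{1}[x]lnK ?posrE// -{1}[1 - x]lnK ?posrE ?subr_gt0//.
  rewrite -!expRM_natr -expRD natrB ?(ltnW kn)// /a; congr expR; field.
  by rewrite gt_eqF.
rewrite !E1// -expRD ler_expR -[- (_ * l)]mulrN -[leRHS]mulrDr ler_pM2l//.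
by lra.
Qed.

(** With [s] the square root, [D (D - 2 l) >= D s >= s^2 = 2 v l]. *)
Lemma empirical_bernstein_gap (R : realType) (v D l : R) :
  0 <= v -> 0 <= l -> Num.sqrt (2 * v * l) + 2 * l <= D ->
  2 * (v + D) * l <= D ^+ 2.
Proof.
move=> v0 l0; set s := Num.sqrt _ => hD.
have s0 : 0 <= s := sqrtr_ge0 _.
have s2 : s ^+ 2 = 2 * v * l by rewrite sqr_sqrtr// !mulr_ge0.
by nra.
Qed.

(** * Joint law of the sample *)

Lemma bernoulli_prob_set1 (R : realType) (q : R) (c : bool) : 0 <= q <= 1 ->
  bernoulli_prob q [set c] = (bernoulli_pmf q c)%:E.
Proof. by move=> q01; rewrite /bernoulli_prob q01 fsbig_set1. Qed.

Section iid.
Variables (R : realType) (K : nat) (d : measure_display).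
Variables (Omega : measurableType d) (Pr : probability Omega R).
Variables (X : 'I_K -> Omega -> bool) (q : R).
Hypothesis (q01 : 0 <= q <= 1) (iidX : iid_bernoulli Pr X q).

(** Indexed by the full set, so that [independent_families] turns its probability into a product. *)
Let fiber (b : {ffun 'I_K -> bool}) : set Omega :=
  \bigcap_(p in [set` [set: 'I_K]%SET]) X p @^-1` [set b p].

Let measurable_fiber b : measurable (fiber b).
Proof.
have [mX _ _] := iidX.
apply: fin_bigcap_measurable; first exact: finite_finset.
by move=> p _; rewrite -[_ @^-1` _]setTI; exact: mX.
Qed.

Let prob_fiber b : Pr (fiber b) = (\prod_p bernoulli_pmf q (b p))%:E.
Proof.
have [_ indX distX] := iidX.
rewrite /fiber indX => [|p _]; last by exists [set b p] => //; rewrite setTI.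
rewrite -prodEFin; apply: eq_big => [p|p _]; first by rewrite inE.
by rewrite -(bernoulli_prob_set1 _ q01) -(distX p).
Qed.

(** The sample takes finitely many values, so measurability and probability of any event about it
    reduce to the fibers, which are disjoint. *)
Let eventE (B : pred {ffun 'I_K -> bool}) :
  [set om | B [ffun p => X p om]] = \bigcup_(b in [set` B]) fiber b.
Proof.
apply/seteqP; split=> [om Bom|om [b Bb Xb]] /=.
  by exists [ffun p => X p om] => // p _; rewrite /= ffunE.
have -> : [ffun p => X p om] = b; last by [].
by apply/ffunP => p; rewrite ffunE; apply: Xb; rewrite /= inE.
Qed.

Lemma iid_bernoulli_measurable (B : pred {ffun 'I_K -> bool}) :
  measurable [set om | B [ffun p => X p om]].
Proof. by rewrite eventE; apply: fin_bigcup_measurable. Qed.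

Lemma iid_bernoulli_prob (B : pred {ffun 'I_K -> bool}) :
  Pr [set om | B [ffun p => X p om]] =
  (\sum_(b | B b) \prod_p bernoulli_pmf q (b p))%:E.
Proof.
rewrite eventE measure_fin_bigcup//; last first.
  move=> b b' _ _ [om [Xb Xb']]; apply/ffunP => p.
  by transitivity (X p om); [symmetry; apply: Xb | apply: Xb']; rewrite /= finset.in_setT.
rewrite (fsbigE (enum B)) ?enum_uniq//; first last.
- by move=> b Bb; rewrite mem_enum => /negP[].
- by move=> b /=; rewrite mem_enum.
rewrite big_enum_cond/= -sumEFin; apply: eq_big => [b|b _].
  by rewrite mem_setE andbb.
exact: prob_fiber.
Qed.

End iid.

(** * Lower tail by change of parameter *)

Section weight.
Variables (R : realType) (K : nat).
Implicit Types (q a : R) (b : {ffun 'I_K -> bool}).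

Lemma bernoulli_pmf_prod q b :
  \prod_p bernoulli_pmf q (b p) = q ^+ #|[pred p | b p]| * (1 - q) ^+ (K - #|[pred p | b p]|).
Proof.
rewrite (bigID (fun p => b p))/=; congr (_ * _).
  rewrite (eq_bigr (fun=> q)) ?prodr_const// => p bp.
  by rewrite /bernoulli_pmf bp.
rewrite (eq_bigr (fun=> 1 - q)) => [|p /negbTE bp].
  rewrite prodr_const; congr (_ ^+ _).
  have := cardC [pred p | b p]; rewrite [RHS]card_ord => cardb.
  by rewrite -[K in (K - _)%N]cardb addKn; apply: eq_card.
by rewrite /bernoulli_pmf bp.
Qed.

(** Distributivity: this is the expansion of [(q + (1 - q))^K]. *)
Lemma sum_bernoulli_pmf_prod q :
  \sum_(b : {ffun 'I_K -> bool}) \prod_p bernoulli_pmf q (b p) = 1.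
Proof.
rewrite -(bigA_distr_bigA (fun _ c => bernoulli_pmf q c)).
by apply: big1 => p _; rewrite big_bool/= subrKC.
Qed.

(* Monotonicity of the likelihood ratio, cross-multiplied because [a] may be 0. *)
Lemma likelihood_ratio_le q a (j k : nat) : 0 <= a -> a <= q -> q <= 1 ->
  (j <= k <= K)%N ->
  q ^+ j * (1 - q) ^+ (K - j) * (a ^+ k * (1 - a) ^+ (K - k)) <=
  q ^+ k * (1 - q) ^+ (K - k) * (a ^+ j * (1 - a) ^+ (K - j)).
Proof.
move=> a0 aq q1 /andP[jk kK].
have q0 := le_trans a0 aq.
have -> : (K - j = (K - k) + (k - j))%N by rewrite addnBA// subnK.
have splitk (x : R) : x ^+ k = x ^+ j * x ^+ (k - j) by rewrite -exprD subnKC.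
rewrite (splitk q) (splitk a) !exprD.
set Q := q ^+ j; set Q' := (1 - q) ^+ (K - k).
set A := a ^+ j; set A' := (1 - a) ^+ (K - k).
(* Once the common factor [Q Q' A A'] is removed, the claim is a power of [(1 - q) a <= q (1 - a)],
   that is, of [a <= q]. *)
have : (1 - q) ^+ (k - j) * a ^+ (k - j) <= q ^+ (k - j) * (1 - a) ^+ (k - j).
  rewrite -!exprMn; apply: lerXn2r; rewrite ?nnegrE ?mulr_ge0//; nra.
have : 0 <= Q * Q' * A * A'.
  by rewrite !mulr_ge0// exprn_ge0//; lra.
move=> h1 h2; have := ler_wpM2l h1 h2.
by congr (_ <= _); ring.
Qed.

(** On [B] the likelihood ratio of [q] to [a] is largest at the maximal count [k], where it is at
    most [exp (- K l)]; the law with parameter [a] gives [B] mass at most 1. *)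
Lemma bernoulli_lower_tail q l (B : pred {ffun 'I_K -> bool}) :
  (0 < K)%N -> q <= 1 ->
  (forall b, B b -> let a := #|[pred p | b p]|%:R / K%:R in
     a < q /\ 2 * (a * (1 - a) + (q - a)) * l <= (q - a) ^+ 2) ->
  \sum_(b | B b) \prod_p bernoulli_pmf q (b p) <= expR (- (K%:R * l)).
Proof.
move=> K0 q1 hB.
have [b0 Bb0|B0] := pickP B; last by rewrite big_pred0// expR_ge0.
have [b Bb bmax] := arg_maxnP (fun b : {ffun 'I_K -> bool} => #|[pred p | b p]|) Bb0.
have [] := hB b Bb.
set k := #|[pred p | b p]| in bmax *; set a := k%:R / K%:R => aq hl.
have K0' : 0 < K%:R :> R by rewrite ltr0n.
have a0 : 0 <= a by rewrite divr_ge0.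
have a1 : a < 1 := lt_le_trans aq q1.
have kK : (k < K)%N by move: a1; rewrite ltr_pdivrMr// mul1r ltr_nat.
set A := a ^+ k * (1 - a) ^+ (K - k).
have A0 : 0 < A.
  apply: mulr_gt0; last by rewrite exprn_gt0// subr_gt0.
  (* At [k = 0] also [a = 0], and the factor is [0^0 = 1]. *)
  have [->|k0] := posnP k; first by rewrite expr0.
  by rewrite exprn_gt0// divr_gt0// ltr0n.
have hw := bernoulli_weight_le kK (introT andP (conj aq q1)) hl.
rewrite -(ler_pM2r A0); apply: le_trans hw; rewrite mulr_suml.
have W0 : 0 <= q ^+ k * (1 - q) ^+ (K - k).
  by rewrite mulr_ge0// exprn_ge0//; lra.
apply: (@le_trans _ _ (q ^+ k * (1 - q) ^+ (K - k) *
    \sum_(b | B b) \prod_p bernoulli_pmf a (b p))).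
  rewrite mulr_sumr; apply: ler_sum => c Bc.
  rewrite !bernoulli_pmf_prod; apply: likelihood_ratio_le => //; first exact: ltW.
  by rewrite (ltnW kK) andbT; exact: bmax.
rewrite -[leRHS]mulr1; apply: ler_wpM2l => //.
rewrite -[leRHS](sum_bernoulli_pmf_prod a) [leRHS](bigID B)/= lerDl.
apply: sumr_ge0 => c _; apply: prodr_ge0 => p _; apply: bernoulli_pmf_ge0.
by rewrite a0 ltW.
Qed.
End weight.

(** * Sample mean and variance as functions of the count *)

Section sample.
Variables (R : realType) (K : nat).

Lemma sum_bool_card (b : 'I_K -> bool) :
  \sum_p (b p)%:R = #|[pred p | b p]|%:R :> R.
Proof.
by rewrite -natr_sum -sum1_card [in RHS]big_mkcond/=; congr (_%:R).
Qed.

Lemma sample_meanE (b : 'I_K -> bool) :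
  sample_mean R b = #|[pred p | b p]|%:R / K%:R.
Proof. by rewrite /sample_mean sum_bool_card mulrC. Qed.

(** The diagonal contributes nothing, and symmetry exchanges the two triangles. *)
Lemma sum_ltn_symmetric (g : 'I_K -> 'I_K -> R) :
  (forall p, g p p = 0) -> (forall p q, g p q = g q p) ->
  \sum_(p < K) \sum_(q < K | (p < q)%N) g p q = 2^-1 * \sum_p \sum_q g p q.
Proof.
move=> g0 gC.
have split_lt (p : 'I_K) : \sum_q g p q =
    \sum_(q < K | (p < q)%N) g p q + \sum_(q < K | (q < p)%N) g p q.
  rewrite (bigID (fun q : 'I_K => (p < q)%N))/=; congr (_ + _).
  rewrite (bigD1 p)/= ?ltnn// g0 add0r; apply: eq_bigl => q.
  by rewrite -leqNgt -val_eqE/= andbC -ltn_neqAle.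
rewrite (eq_bigr _ (fun p _ => split_lt p)) big_split/=.
rewrite [X in _ + X](exchange_big_dep predT)//=.
have -> : \sum_(q < K) \sum_(p < K | (q < p)%N) g p q =
    \sum_(p < K) \sum_(q < K | (p < q)%N) g p q.
  by apply: eq_bigr => p _; apply: eq_bigr => q _; exact: gC.
by field.
Qed.

Lemma sample_varE (b : 'I_K -> bool) : let k := #|[pred p | b p]|%:R in
  sample_var R b = k * (K%:R - k) / (K%:R * (K%:R - 1)).
Proof.
move=> k; rewrite /sample_var mulrC; congr (_ / _).
rewrite (sum_ltn_symmetric (g := fun p q => ((b p)%:R - (b q)%:R) ^+ 2)); last 2 first.
- by move=> p; rewrite subrr expr0n.
- by move=> p q; rewrite -sqrrN opprB.
transitivity (2^-1 * \sum_(p < K) (K%:R * (b p)%:R + k - 2 * (b p)%:R * k)).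
  congr (_ * _); apply: eq_bigr => p _.
  (* Values in [{0, 1}] equal their squares, so the squared difference is [x + y - 2 x y]. *)
  rewrite (eq_bigr (fun q => (b p)%:R + (b q)%:R - 2 * (b p)%:R * (b q)%:R)).
    rewrite sumrB big_split/= sumr_const card_ord -mulr_sumr sum_bool_card -/k.
    by rewrite -[_ *+ K]mulr_natl.
  by move=> q _; case: (b p); case: (b q) => /=; ring.
rewrite sumrB big_split/= -mulr_sumr -mulr_suml -mulr_sumr !sum_bool_card -/k.
rewrite sumr_const card_ord -[_ *+ K]mulr_natl.
by field.
Qed.

(** The sample variance is [a (1 - a) K / (K - 1) >= a (1 - a)], and [7 / (3 (K - 1)) >= 2 / K].
    Failure of the bound thus yields the premise of [empirical_bernstein_gap] with [D = q - a] and
    [l = L / K]. *)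
Lemma empirical_bernstein_violation (q L : R) (b : 'I_K -> bool) :
  (1 < K)%N -> 0 <= L ->
  sample_mean R b + Num.sqrt (2 * sample_var R b * L / K%:R)
    + 7 * L / (3 * (K%:R - 1)) < q ->
  let a := #|[pred p | b p]|%:R / K%:R in
  a < q /\ 2 * (a * (1 - a) + (q - a)) * (L / K%:R) <= (q - a) ^+ 2.
Proof.
move=> K1 L0; rewrite sample_meanE sample_varE.
set k := #|_|%:R => + a; rewrite -[k / K%:R]/a => hq.
have K1' : 1 < K%:R :> R by rewrite ltr1n.
have K0 : 0 < K%:R :> R by lra.
have k0 : 0 <= k by [].
have kK : k <= K%:R by rewrite ler_nat -[K in leqRHS]card_ord max_card.
have kE : k = a * K%:R by rewrite /a divfK// gt_eqF.
have a0 : 0 <= a by rewrite divr_ge0.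
have a1 : a <= 1 by rewrite ler_pdivrMr// mul1r.
have v0 : 0 <= a * (1 - a) by rewrite mulr_ge0// subr_ge0.
have var_ge : a * (1 - a) <= k * (K%:R - k) / (K%:R * (K%:R - 1)).
  rewrite ler_pdivlMr ?mulr_gt0 ?subr_gt0// kE; nra.
have l0 : 0 <= L / K%:R by rewrite divr_ge0// ltW.
have sqrt_le : Num.sqrt (2 * (a * (1 - a)) * (L / K%:R)) <=
    Num.sqrt (2 * (k * (K%:R - k) / (K%:R * (K%:R - 1))) * L / K%:R).
  by apply: ler_wsqrtr; rewrite -(mulrA _ L); apply: ler_wpM2r => //; lra.
have lin_le : 2 * (L / K%:R) <= 7 * L / (3 * (K%:R - 1)).
  rewrite mulrA ler_pdivrMr// mulrAC ler_pdivlMr; last by lra.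
  by nra.
have s0 := sqrtr_ge0 (2 * (a * (1 - a)) * (L / K%:R)).
have hD : Num.sqrt (2 * (a * (1 - a)) * (L / K%:R)) + 2 * (L / K%:R) <= q - a.
  by lra.
split; last exact: empirical_bernstein_gap.
have : 0 <= 7 * L / (3 * (K%:R - 1)) by apply: le_trans lin_le; rewrite mulr_ge0.
by lra.
Qed.

End sample.

(** * Concentration bound and its application to rollouts *)

Lemma empirical_bernstein_bernoulli (R : realType) (K : nat)
    (d : measure_display) (Omega : measurableType d) (Pr : probability Omega R)
    (X : 'I_K -> Omega -> bool) (q delta : R) :
  (1 < K)%N -> 0 <= q <= 1 -> 0 < delta < 1 -> iid_bernoulli Pr X q ->
  ((1 - delta)%:E <= Pr [set om | (q <= sample_mean R (X ^~ om)
      + Num.sqrt (2 * sample_var R (X ^~ om) * ln (2 / delta) / K%:R)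
      + 7 * ln (2 / delta) / (3 * (K%:R - 1)))%R])%E.
Proof.
move=> K1 q01 /andP[d0 d1] iidX.
have [_ q1] := andP q01.
set L := ln (2 / delta).
have L0 : 0 <= L by rewrite ln_ge0// ler_pdivlMr//; lra.
pose B (b : {ffun 'I_K -> bool}) := sample_mean R b
  + Num.sqrt (2 * sample_var R b * L / K%:R) + 7 * L / (3 * (K%:R - 1)) < q.
have -> : [set om | q <= sample_mean R (X ^~ om)
      + Num.sqrt (2 * sample_var R (X ^~ om) * L / K%:R)
      + 7 * L / (3 * (K%:R - 1))] = ~` [set om | B [ffun p => X p om]].
  apply/seteqP; rewrite /B.
  have XE om : ([ffun p => X p om] : 'I_K -> bool) = X ^~ om.
    by apply/funext => p; rewrite ffunE.
  by split=> om /=; rewrite XE leNgt => /negP.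
rewrite probability_setC; last exact: (iid_bernoulli_measurable iidX).
rewrite (iid_bernoulli_prob q01 iidX) -EFinB lee_fin lerB//.
have K0 : 0 < K%:R :> R by rewrite ltr0n ltnW.
apply: (@le_trans _ _ (expR (- (K%:R * (L / K%:R))))).
  apply: bernoulli_lower_tail => //; first exact: ltnW.
  by move=> b Bb; exact: (empirical_bernstein_violation K1 L0 Bb).
(* The failure probability is at most [exp (- L) = delta / 2], within the allowed [delta]. *)
rewrite mulrC divfK ?gt_eqF// /L expRN lnK ?posrE ?divr_gt0// invf_div.
by lra.
Qed.

(* rho p is the p-th observed rollout and rhoZ a generic one, whose normalized
   margin is Z. *)
Theorem mainTheorem1 (R : realType) (N n m P : nat)
    (f : 'I_N -> 'cV[R]_n -> 'cV[R]_n) (g : 'I_N -> 'cV[R]_n -> 'M[R]_(n, m))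
    (h : 'I_N -> 'I_N -> 'M[R]_(n, N) -> R) (alpha : R -> R)
    (psi eps epsn wbar T hmin theta delta : R)
    (d : measure_display) (Omega : measurableType d) (Pr : probability Omega R)
    (rho : 'I_P -> Omega -> trajectory R n m N)
    (rhoZ : Omega -> trajectory R n m N)
    (hP : (1 < P)%N)
    (hf : forall i, locally_lipschitz (f i))
    (hg : forall i, locally_lipschitz (g i))
    (hh : forall i j : 'I_N, i != j -> continuously_differentiable (h i j))
    (halpha : extended_class_K alpha)
    (hpsi : 0 <= psi) (heps : 0 < eps) (hepsn : 0 < epsn)
    (hwbar : 0 < wbar) (hT : 0 < T) (hhmin : 0 < hmin)
    (htheta : 0 < theta < 1) (hdelta : 0 < delta < 1)
    (hrho : forall p om,
       cbf_trajectory f g h psi eps wbar T alpha hmin (rho p om))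
    (hrhoZ : forall om,
       cbf_trajectory f g h psi eps wbar T alpha hmin (rhoZ om))
    (hindep : independent_rollouts Pr T rho) :
  let margin_of om pi :=
    normalized_margin h psi eps epsn T (fun p => rho p om) pi in
  let Z om := margin_of om (rhoZ om) in
  let Zs p om := margin_of om (rho p om) in
  let X p om := Zs p om < theta in
  let pviol := fine (Pr [set om | Z om < theta]) in
  (forall p om, 0 <= Zs p om <= 1) ->
  measurable [set om | Z om < theta] ->
  iid_bernoulli Pr X pviol ->
  let risk_bound om :=
    let phat := sample_mean R (X ^~ om) in
    let var := sample_var R (X ^~ om) in
    phat + Num.sqrt (2 * var * ln (2 / delta) / P%:R)
      + 7 * ln (2 / delta) / (3 * (P%:R - 1)) in
  ((1 - delta)%:E <= Pr [set om | (pviol <= risk_bound om)%R])%E.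
Proof.
move=> margin_of Z Zs X pviol _ mZ iidX.
(* The Bernoulli model supplies the concentration bound with [q = pviol]; it remains to see that
   [pviol] lies in [[0, 1]]. *)
apply: empirical_bernstein_bernoulli => //.
by rewrite fine_ge0 ?measure_ge0//= -lee_fin fineK ?fin_num_measure// probability_le1.
Qed.
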